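(* Let $n\ge 2$, let $D$ be a bounded subdomain of $\mathbb{R}^n$ and let $x_1,x_2\in D$. Then there always exists an $m_D$-geodesic $\gamma$ in $D$ joining $x_1$ and $x_2$, that is, a rectifiable path $\gamma$ in $D$ joining $x_1$ to $x_2$ with $$\int_\gamma m_D(z)\,|dz| = m_D(x_1,x_2).$$
   Context: For a bounded domain (non-empty open connected set) $D\subset\mathbb{R}^n$, $\delta_D(z)=\inf\{|z-\xi|:\xi\in\partial D\}$, $d(D)=\sup\{|x-y|:x,y\in D\}$, and $$m_D(z)=\frac{d(D)}{\delta_D(z)\,(d(D)-\delta_D(z))},\quad z\in D.$$ The metric is $m_D(x_1,x_2)=\inf_\gamma\int_\gamma m_D(z)\,|dz|$, the infimum being over all rectifiable paths $\gamma$ in $D$ joining $x_1$ to $x_2$. *)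

(* Defs.v *)
From HB Require Import structures.
From mathcomp Require Import all_boot all_order all_algebra.
From mathcomp Require Import all_classical all_reals all_analysis.
Import numFieldNormedType.Exports.

Set Implicit Arguments.
Unset Strict Implicit.
Unset Printing Implicit Defensive.

Import Order.TTheory GRing.Theory Num.Theory.
Local Open Scope classical_set_scope.
Local Open Scope ring_scope.

(* R^n is 'rV[R]_n. The library norm `|x| on row vectors is the max norm, so
   the Euclidean norm is defined here and used for every metric quantity. The
   topology and the bounded sets do not depend on the choice of the norm, so
   [open], [connected], [closure], [continuous] and [bounded_set] are the
   library notions. *)
Definition enorm (R : realType) (n : nat) (x : 'rV[R]_n) : R :=
  Num.sqrt (\sum_(i < n) x ord0 i ^+ 2).

Definition is_domain (R : realType) (n : nat) (D : set 'rV[R]_n) : Prop :=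
  [/\ D !=set0, open D & connected D].

Definition boundary (R : realType) (n : nat) (D : set 'rV[R]_n) :
  set 'rV[R]_n := closure D `\` interior D.

(* A nonempty bounded open D in R^n, n >= 1, has a nonempty boundary, so [inf]
   (which is 0 on the empty set) is the genuine infimum; likewise the set in
   [diameter] is nonempty and bounded above. *)
Definition boundary_dist (R : realType) (n : nat) (D : set 'rV[R]_n)
  (z : 'rV[R]_n) : R := inf [set enorm (z - xi) | xi in boundary D].

Definition diameter (R : realType) (n : nat) (D : set 'rV[R]_n) : R :=
  sup [set enorm (p.1 - p.2) | p in D `*` D].

Definition m_density (R : realType) (n : nat) (D : set 'rV[R]_n)
  (z : 'rV[R]_n) : R :=
  diameter D / (boundary_dist D z * (diameter D - boundary_dist D z)).

(* A path is a function on R of which only the restriction to [a, b]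
   matters. *)
Definition joining_path (R : realType) (n : nat) (D : set 'rV[R]_n)
  (x1 x2 : 'rV[R]_n) (a b : R) (g : R -> 'rV[R]_n) : Prop :=
  [/\ a < b, {within `[a, b], continuous g},
      (forall t, t \in `[a, b] -> D (g t)), g a = x1 & g b = x2].

Definition path_length (R : realType) (n : nat) (a b : R)
  (g : R -> 'rV[R]_n) : \bar R :=
  ereal_sup [set (\sum_(0 <= k < size s)
      enorm (g (nth b (a :: s) k.+1) - g (nth b (a :: s) k)))%:E
    | s in itv_partition a b].

Definition rectifiable_path (R : realType) (n : nat) (D : set 'rV[R]_n)
  (x1 x2 : 'rV[R]_n) (a b : R) (g : R -> 'rV[R]_n) : Prop :=
  joining_path D x1 x2 a b g /\ (path_length a b g < +oo)%E.

(* The normal representation of g: the point of the path reached after arc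
   length s. Two parameters t with the same arc length bound an interval on
   which g is constant, so the value does not depend on the t chosen. *)
Definition arclength_param (R : realType) (n : nat) (a b : R)
  (g : R -> 'rV[R]_n) (s : R) : 'rV[R]_n :=
  g (xget a [set t | t \in `[a, b] /\ path_length a t g = s%:E]).

(* The integral of f with respect to arc length along a rectifiable path,
   computed in the arc length parametrization. *)
Definition path_integral (R : realType) (n : nat) (a b : R)
  (g : R -> 'rV[R]_n) (f : 'rV[R]_n -> R) : \bar R :=
  (\int[lebesgue_measure]_(s in `[0%R, fine (path_length a b g)])
     (f (arclength_param a b g s))%:E)%E.

(* The infimum is taken in the extended reals. For x1, x2 in a bounded domain
   it is a real number: some rectifiable path joins them, and the density is
   positive on D and bounded on the compact trace of each such path. *)
Definition m_dist (R : realType) (n : nat) (D : set 'rV[R]_n)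
  (x1 x2 : 'rV[R]_n) : \bar R :=
  ereal_inf [set l | exists (a b : R) (g : R -> 'rV[R]_n),
    rectifiable_path D x1 x2 a b g /\ l = path_integral a b g (m_density D)].

Definition m_geodesic (R : realType) (n : nat) (D : set 'rV[R]_n)
  (x1 x2 : 'rV[R]_n) (a b : R) (g : R -> 'rV[R]_n) : Prop :=
  rectifiable_path D x1 x2 a b g /\
  path_integral a b g (m_density D) = m_dist D x1 x2.

(* Main.v *)
Require Import Defs.
From mathcomp Require Import all_boot all_order all_algebra.
From mathcomp Require Import all_classical all_reals all_analysis.
From mathcomp Require Import ring lra.
Import numFieldNormedType.Exports.
Import Order.TTheory GRing.Theory Num.Theory.
Set Implicit Arguments.
Unset Strict Implicit.
Unset Printing Implicit Defensive.
Local Open Scope classical_set_scope.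
Local Open Scope ring_scope.

(** The proof is the direct method of the calculus of variations. Write [delta]
    for the distance to the boundary and [m] for the density. Since
    [2 delta <= diameter D] on [D], the density is
    [1 / delta + 1 / (diameter D - delta)]; it dominates [1 / delta] and
    [2 / diameter D], and it is Lipschitz on each set [{delta >= c}] with [c > 0].

    Some rectifiable path joins the two points ([rectifiable_connected]), so
    [m_dist] is a real number [M]. Take paths whose weighted lengths tend to [M],
    in arc length parametrization. From [m >= 2 / diameter D] their lengths are
    bounded ([unit_speed_length_le]); from [m >= 1 / delta] the function
    [ln delta] varies along a path by at most its weighted length, so all these
    paths stay in one set [{delta >= c}] ([bdist_unit_speed_ge]). Rescaled to
    [[0, 1]], they are uniformly Lipschitz, and they converge pointwise along an
    ultrafilter to a Lipschitz path [H] in [D]; the lengths, and the weighted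
    lengths of the initial arcs, converge along it too ([unit_speed_limit]).

    That the weighted length of [H] is at most [M] follows without any
    semicontinuity of length. The increment over [[t, t']] of the limit [J] of
    the weighted lengths is at least [m (H t) L (t' - t)] up to a multiple of
    [(t' - t)^2], where [L] is the limit of the lengths. The increment of the
    weighted length of [H] is at most this quantity up to a multiple of
    [(t' - t)^2], because [H] is [L]-Lipschitz. A function whose increments are
    at most quadratic in those of its argument cannot increase
    ([quadratic_increments]), and summing gives the claim. The same lemma yields
    both a priori bounds.

    The paths and their integrals are given through the arc length
    parametrization, which is meaningful because arc length is additive
    ([arclenD]) and takes all intermediate values ([arclen_onto]). *)

(** * The Euclidean norm *)

Section EuclideanNorm.
Context {R : realType} {n : nat}.
Implicit Types (x y z : 'rV[R]_n) (k : R).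

Lemma sumsq_ge0 x : 0 <= \sum_(i < n) x ord0 i ^+ 2.
Proof. by apply: sumr_ge0 => i _; exact: sqr_ge0. Qed.

Lemma enorm_ge0 x : 0 <= enorm x.
Proof. exact: sqrtr_ge0. Qed.

Lemma sqr_enorm x : enorm x ^+ 2 = \sum_(i < n) x ord0 i ^+ 2.
Proof. by rewrite sqr_sqrtr// sumsq_ge0. Qed.

Lemma enorm0 : enorm (0 : 'rV[R]_n) = 0.
Proof.
rewrite /enorm big1 ?sqrtr0// => i _.
by rewrite mxE expr0n.
Qed.

Lemma enormZ k x : enorm (k *: x) = `|k| * enorm x.
Proof.
rewrite /enorm -sqrtr_sqr -sqrtrM ?sqr_ge0// mulr_sumr.
by congr Num.sqrt; apply: eq_bigr => i _; rewrite mxE exprMn.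
Qed.

Lemma enormN x : enorm (- x) = enorm x.
Proof. by rewrite -scaleN1r enormZ normrN1 mul1r. Qed.

Lemma enormC x y : enorm (x - y) = enorm (y - x).
Proof. by rewrite -enormN opprB. Qed.

Lemma ler_coord_enorm x i : `|x ord0 i| <= enorm x.
Proof.
rewrite -(@ler_pXn2r _ 2)// ?nnegrE ?enorm_ge0// sqr_enorm real_normK ?num_real//.
by rewrite (bigD1 i)//= lerDl sumr_ge0// => j _; exact: sqr_ge0.
Qed.

Lemma cauchy_schwarz x y : \sum_(i < n) x ord0 i * y ord0 i <= enorm x * enorm y.
Proof.
have [y0|y0] := eqVneq (enorm y) 0.
  rewrite y0 mulr0 big1// => i _.
  have := ler_coord_enorm y i; rewrite y0 normr_le0 => /eqP ->.
  by rewrite mulr0.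
have [x0|x0] := eqVneq (enorm x) 0.
  rewrite x0 mul0r big1// => i _.
  have := ler_coord_enorm x i; rewrite x0 normr_le0 => /eqP ->.
  by rewrite mul0r.
set X := enorm x; set Y := enorm y; set S := \sum_(i < n) _.
have Xp : 0 < X by rewrite lt_neqAle eq_sym x0 enorm_ge0.
have Yp : 0 < Y by rewrite lt_neqAle eq_sym y0 enorm_ge0.
(* expand the nonnegative quantity [sum_i (Y x_i - X y_i)^2] *)
have : 0 <= \sum_(i < n) (Y * x ord0 i - X * y ord0 i) ^+ 2.
  by apply: sumr_ge0 => i _; exact: sqr_ge0.
have -> : \sum_(i < n) (Y * x ord0 i - X * y ord0 i) ^+ 2 =
    Y ^+ 2 * X ^+ 2 + X ^+ 2 * Y ^+ 2 - 2 * (X * Y) * S.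
  rewrite /X /Y !sqr_enorm -/X -/Y !mulr_sumr -!big_split/= -sumrB.
  apply: eq_bigr => i _.
  rewrite -!sqr_enorm -/X -/Y.
  by ring.
have XY : 0 < X * Y by rewrite mulr_gt0.
rewrite (_ : _ - _ = 2 * (X * Y) * (X * Y - S)); last by ring.
by rewrite pmulr_rge0 ?mulr_gt0// subr_ge0.
Qed.

Lemma ler_enormD x y : enorm (x + y) <= enorm x + enorm y.
Proof.
rewrite -(@ler_pXn2r _ 2)// ?nnegrE ?addr_ge0 ?enorm_ge0// sqr_enorm.
rewrite sqrrD !sqr_enorm.
have -> : \sum_(i < n) (x + y) ord0 i ^+ 2 = \sum_(i < n) x ord0 i ^+ 2
    + (\sum_(i < n) x ord0 i * y ord0 i) *+ 2 + \sum_(i < n) y ord0 i ^+ 2.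
  rewrite -sumrMnl -!big_split/=; apply: eq_bigr => i _.
  by rewrite mxE sqrrD.
by rewrite lerD2r lerD2l lerMn2r cauchy_schwarz.
Qed.

Lemma ler_enormB z x y : enorm (x - y) <= enorm (x - z) + enorm (z - y).
Proof. by rewrite -[x - y](subrKA z) ler_enormD. Qed.

Lemma norm_le_enorm x : `|x| <= enorm x.
Proof.
rewrite /Num.Def.normr/= mx_normrE; apply: bigmax_le => [|[i j] _ /=].
  exact: enorm_ge0.
by rewrite ord1 ler_coord_enorm.
Qed.

Lemma enorm_le_norm x : enorm x <= n%:R * `|x|.
Proof.
rewrite -(@ler_pXn2r _ 2)// ?nnegrE ?enorm_ge0 ?mulr_ge0// sqr_enorm exprMn.
have h (i : 'I_n) : `|x ord0 i| <= `|x|.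
  rewrite [leRHS]/Num.Def.normr/= mx_normrE.
  exact: (le_bigmax _ (fun ij => `|x ij.1 ij.2|) (ord0, i)).
apply: (@le_trans _ _ (\sum_(i < n) `|x| ^+ 2)).
  apply: ler_sum => i _; rewrite -[leLHS]real_normK ?num_real//.
  by rewrite ler_pXn2r ?nnegrE.
rewrite sumr_const card_ord -[leLHS]mulr_natl ler_wpM2r ?sqr_ge0//.
case: (posnP n) => [->|n0]; first by rewrite expr0n.
by rewrite expr2 ler_peMl// ler1n.
Qed.

End EuclideanNorm.

(** * Arc length *)

Section ArcLength.
Context {R : realType} {n : nat}.
Implicit Types (a b c t : R) (g : R -> 'rV[R]_n) (s : seq R).

(** Length of the polygon with vertices the images under [g] of the points of
    [a :: s], by recursion on [s]. *)
Fixpoint polygon_length g a s : R :=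
  if s is x :: s' then enorm (g x - g a) + polygon_length g x s' else 0.

Lemma polygon_lengthE g d a s :
  \sum_(0 <= k < size s)
    enorm (g (nth d (a :: s) k.+1) - g (nth d (a :: s) k)) =
  polygon_length g a s.
Proof.
elim: s a => [|x s ih] a /=; first by rewrite big_nil.
by rewrite big_nat_recl//= -ih.
Qed.

Lemma polygon_length_cat g a s1 s2 :
  polygon_length g a (s1 ++ s2) =
  polygon_length g a s1 + polygon_length g (last a s1) s2.
Proof. by elim: s1 a => [|x s1 ih] a /=; rewrite ?add0r// ih addrA. Qed.

Lemma polygon_length_ge0 g a s : 0 <= polygon_length g a s.
Proof. by elim: s a => //= x s ih a; rewrite addr_ge0 ?enorm_ge0. Qed.

(** Inserting a point into a partition does not shorten the polygon. *)
Lemma itv_partition_split g a b c s : a <= c <= b -> itv_partition a b s ->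
  exists s1 s2, [/\ itv_partition a c s1, itv_partition c b s2 &
    polygon_length g a s <= polygon_length g a s1 + polygon_length g c s2].
Proof.
elim: s a => [|x s ih] a /andP[ac cb] abs.
  have ab := itv_partition_nil abs.
  have -> : c = b by apply/eqP; rewrite eq_le cb -ab ac.
  by exists [::], [::]; rewrite ab; split; [split=> /=..|rewrite /= addr0].
have xbs := itv_partition_cons abs.
have ax : a < x by case: abs => /= /andP[].
have [xc|cx] := leP x c.
  have [|s1 [s2 [p1 p2 le12]]] := ih x _ xbs; first by rewrite xc cb.
  exists (x :: s1), s2; split => //.
    by case: p1 => p1 l1; split => //=; rewrite ax.
  by rewrite /= -addrA lerD2l.
have cbs : itv_partition c b (x :: s).
  by case: xbs => p l; split => //=; rewrite cx.
have [ac'|ac'] := eqVneq a c.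
  exists [::], (x :: s); rewrite ac'; split => //.
  by rewrite /= add0r.
exists [:: c], (x :: s); split => //.
  by apply: itv_partition1; rewrite lt_neqAle ac' ac.
rewrite /= addr0 addrA lerD2r [leRHS]addrC.
exact: ler_enormB.
Qed.

Lemma itv_partition_ex a b : a <= b -> exists s, itv_partition a b s.
Proof.
rewrite le_eqVlt => /predU1P[->|ab]; first by exists [::].
by exists [:: b]; exact: itv_partition1.
Qed.

(** Arc length as a real number; it is the genuine value only when the length
    is finite, as it is on every subinterval of a rectifiable path. *)
Definition arclen g a b : R := fine (path_length a b g).

Lemma path_length_ge0 g a b : a <= b -> (0 <= path_length a b g)%E.
Proof.
move=> /itv_partition_ex[s abs]; apply: le_ereal_sup_tmp.
eexists; first by exists s.
by rewrite lee_fin polygon_lengthE polygon_length_ge0.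
Qed.

Lemma path_length_le g a b C :
  (forall s, itv_partition a b s -> polygon_length g a s <= C) ->
  (path_length a b g <= C%:E)%E.
Proof.
move=> h; apply: ge_ereal_sup => _ [s abs <-].
by rewrite polygon_lengthE lee_fin h.
Qed.

Lemma arclen_ge0 g a b : a <= b -> 0 <= arclen g a b.
Proof. by move=> ab; rewrite /arclen fine_ge0// path_length_ge0. Qed.

Lemma arclenxx g a : arclen g a a = 0.
Proof.
have h : (path_length a a g <= 0%:E)%E.
  by apply: path_length_le => s /itv_partitionxx ->.
rewrite /arclen (_ : path_length a a g = 0%E)//.
by apply/eqP; rewrite eq_le h path_length_ge0.
Qed.

Section rectifiable.
Variables (g : R -> 'rV[R]_n) (a b : R).
Hypothesis finl : (path_length a b g < +oo)%E.

Lemma path_length_fin c d : a <= c -> c <= d -> d <= b ->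
  path_length c d g = (arclen g c d)%:E.
Proof.
move=> ac cd db; rewrite /arclen fineK// ge0_fin_numE ?path_length_ge0//.
apply: le_lt_trans finl; apply: ge_ereal_sup => _ [s cds <-].
have [s1 acs1] := itv_partition_ex ac.
have [s2 dbs2] := itv_partition_ex db.
apply: le_ereal_sup_tmp; eexists.
  exists (s1 ++ s ++ s2) => //.
  by apply: (itv_partition_cat acs1); exact: (itv_partition_cat cds).
rewrite !polygon_lengthE lee_fin !polygon_length_cat.
have -> : last a s1 = c by case: acs1 => _ /eqP.
by rewrite addrCA lerDl addr_ge0 ?polygon_length_ge0.
Qed.

Lemma polygon_le_arclen c d s : a <= c -> c <= d -> d <= b ->
  itv_partition c d s -> polygon_length g c s <= arclen g c d.
Proof.
move=> ac cd db cds; rewrite -lee_fin -path_length_fin//.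
by apply: ereal_sup_ubound; exists s => //; rewrite polygon_lengthE.
Qed.

Lemma arclen_le C c d : a <= c -> c <= d -> d <= b ->
  (forall s, itv_partition c d s -> polygon_length g c s <= C) ->
  arclen g c d <= C.
Proof.
by move=> ac cd db h; rewrite -lee_fin -path_length_fin// path_length_le.
Qed.

Lemma chord_le_arclen c d : a <= c -> c <= d -> d <= b ->
  enorm (g d - g c) <= arclen g c d.
Proof.
move=> ac; rewrite le_eqVlt => /predU1P[<-|cd] db.
  by rewrite subrr enorm0 arclenxx.
have := polygon_le_arclen ac (ltW cd) db (itv_partition1 cd).
by rewrite /= addr0.
Qed.

Lemma arclenD c d e : a <= c -> c <= d -> d <= e -> e <= b ->
  arclen g c e = arclen g c d + arclen g d e.
Proof.
move=> ac cd de eb; have ce := le_trans cd de.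
have ad := le_trans ac cd; have db := le_trans de eb.
apply/eqP; rewrite eq_le; apply/andP; split.
  apply: arclen_le => // s ces.
  have [|s1 [s2 [p1 p2 h]]] := itv_partition_split g _ ces (c := d).
    by rewrite cd de.
  by rewrite (le_trans h)// lerD// polygon_le_arclen.
rewrite -lerBrDr; apply: arclen_le => // s1 p1.
rewrite lerBrDr -lerBrDl; apply: arclen_le => // s2 p2.
rewrite lerBrDl.
have := polygon_le_arclen ac ce eb (itv_partition_cat p1 p2).
rewrite polygon_length_cat.
by have -> : last c s1 = d by case: p1 => _ /eqP.
Qed.

Lemma arclen_nondecr c d : a <= c -> c <= d -> d <= b ->
  arclen g a c <= arclen g a d.
Proof.
by move=> ac cd db; rewrite (arclenD _ ac cd)// lerDl arclen_ge0.
Qed.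

Hypothesis contg : forall t, a <= t <= b -> forall e, 0 < e ->
  exists2 d, 0 < d & forall u, a <= u <= b -> `|u - t| < d ->
    enorm (g u - g t) < e.

(** Lower semicontinuity of arc length in the right end point. *)
Lemma arclen_lsc_right t C : a < t -> t <= b ->
  (forall u, a <= u -> u < t -> arclen g a u <= C) -> arclen g a t <= C.
Proof.
move=> at_ tb h; apply: arclen_le; rewrite ?lexx ?(ltW at_)// => s.
elim/last_ind: s => [|s x _] p.
  by have := itv_partition_nil p => ta; rewrite ta ltxx in at_.
have xt : x = t by case: p => _; rewrite last_rcons => /eqP.
subst x; case: p; rewrite rcons_path => /andP[ps qt] _.
have aq : a <= last a s by apply: (@itv_partition_le _ _ _ _ s); split.
apply/ler_addgt0Pr => e e0.
have [|d d0 hd] := contg (t := t) _ e0; first by rewrite (ltW at_) tb.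
set q := last a s in qt aq *.
(* [u] replaces the last vertex [t]: after the previous vertex [q], and close
   enough to [t] for the continuity of [g]. *)
pose u := Num.max ((q + t) / 2) (t - d / 2).
have qu : q < u by rewrite lt_max; apply/orP; left; lra.
have ut : u < t by rewrite gt_max; apply/andP; split; lra.
have ud : t - d / 2 <= u by rewrite le_max lexx orbT.
have au : a <= u by rewrite ltW// (le_lt_trans aq).
have := h u au ut.
have : polygon_length g a (rcons s u) <= arclen g a u.
  apply: polygon_le_arclen => //; first by rewrite (le_trans (ltW ut)).
  by split; rewrite ?last_rcons// rcons_path ps.
rewrite -!cats1 !polygon_length_cat /= -/q !addr0 => h1 h2.
have h3 : enorm (g u - g t) < e.
  apply: hd; first by rewrite au (le_trans (ltW ut)).
  by rewrite ltr0_norm; lra.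
have h4 := ler_enormB (g u) (g t) (g q).
rewrite (enormC (g t) (g u)) in h4.
lra.
Qed.

(** Lower semicontinuity of arc length in the left end point. *)
Lemma arclen_lsc_left t C : a <= t -> t < b ->
  (forall u, t < u -> u <= b -> arclen g u b <= C) -> arclen g t b <= C.
Proof.
move=> at_ tb h; apply: arclen_le; rewrite ?lexx ?(ltW tb)// => -[|q s] p.
  by have := itv_partition_nil p => ta; rewrite ta ltxx in tb.
have pq := itv_partition_cons p; have qb := itv_partition_le pq.
case: p => /= /andP[tq ps] _.
apply/ler_addgt0Pr => e e0.
have [|d d0 hd] := contg (t := t) _ e0; first by rewrite (ltW tb) at_.
pose u := Num.min ((t + q) / 2) (t + d / 2).
have qu : u < q by rewrite gt_min; apply/orP; left; lra.
have ut : t < u by rewrite lt_min; apply/andP; split; lra.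
have ud : u <= t + d / 2 by rewrite ge_min lexx orbT.
have ub : u <= b by rewrite ltW// (lt_le_trans qu).
have au : a <= u by rewrite (le_trans at_)// ltW.
have := h u ut ub.
have : polygon_length g u (q :: s) <= arclen g u b.
  apply: polygon_le_arclen => //.
  by case: pq => ? ?; split => //=; rewrite qu.
move=> /= h1 h2.
have h3 : enorm (g u - g t) < e.
  by apply: hd; rewrite ?au ?ub// gtr0_norm; lra.
have h4 := ler_enormB (g u) (g q) (g t).
lra.
Qed.

(** Arc length has no jumps: every value up to the total length is attained. *)
Lemma arclen_onto l : a <= b -> 0 <= l <= arclen g a b ->
  exists2 t, a <= t <= b & arclen g a t = l.
Proof.
move=> ab /andP[l0 lb].
pose T := [set t | a <= t <= b /\ arclen g a t <= l].
have Ta : T a by rewrite /T/= lexx ab arclenxx.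
have supT : has_sup T by split; [exists a|exists b => t [/andP[]]].
(* The supremum of the parameters of arc length at most [l]; semicontinuity
   from the left and from the right shows that its arc length is exactly [l]. *)
pose t := sup T.
have at_ : a <= t by exact: ub_le_sup supT.2 _ Ta.
have tb : t <= b by apply: ge_sup; [exists a|move=> u [/andP[]]].
exists t; first by rewrite at_.
apply/eqP; rewrite eq_le; apply/andP; split.
  have [<-|ta] := eqVneq a t; first by rewrite arclenxx.
  apply: arclen_lsc_right => //; first by rewrite lt_neqAle ta.
  move=> u au ut; have [v Tv uv] := sup_gt supT.1 ut.
  have [/andP[av vb] vl] := Tv.
  by rewrite (le_trans _ vl)// arclen_nondecr// ltW.
have [->//|tb'] := eqVneq t b.
have tltb : t < b by rewrite lt_neqAle tb'.
suff : arclen g t b <= arclen g a b - l.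
  by rewrite (arclenD _ at_ tb)//; lra.
apply: arclen_lsc_left => // u tu ub.
have au : a <= u by rewrite (le_trans at_)// ltW.
rewrite (arclenD _ au ub)//.
suff : l <= arclen g a u by lra.
rewrite leNgt; apply/negP => ul.
suff : u <= t by lra.
apply: ub_le_sup supT.2 _ _; split; first by rewrite au.
exact: ltW.
Qed.

Lemma arclength_paramE t : a <= t <= b ->
  arclength_param a b g (arclen g a t) = g t.
Proof.
move=> /andP[at_ tb]; rewrite /arclength_param.
have [] := @xgetPex _ a [set u | u \in `[a, b] /\
    path_length a u g = (arclen g a t)%:E].
  by exists t; split; [rewrite in_itv/= at_|exact: path_length_fin].
set u := xget _ _; rewrite in_itv/= => /andP[au ub].
rewrite path_length_fin// => -[ut].
suff h v w : a <= v -> v <= w -> w <= b -> arclen g a v = arclen g a w ->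
    g v = g w.
  by have [ut'|/ltW tu] := leP u t; [exact: h|apply/esym/h].
move=> av vw wb vwE; have := chord_le_arclen av vw wb.
move: vwE; rewrite (arclenD _ av vw)// => vwE.
have -> : arclen g v w = 0 by lra.
move=> h0; apply/esym/eqP; rewrite -subr_eq0 -normr_le0.
exact: le_trans (norm_le_enorm _) h0.
Qed.

Lemma arclength_param_lipschitz l l' : a <= b ->
  0 <= l <= arclen g a b -> 0 <= l' <= arclen g a b ->
  enorm (arclength_param a b g l - arclength_param a b g l') <= `|l - l'|.
Proof.
move=> ab /(arclen_onto ab)[t tab <-] /(arclen_onto ab)[t' t'ab <-].
rewrite !arclength_paramE//.
wlog tt : t t' tab t'ab / t <= t'.
  move=> h; have [tt|/ltW tt] := leP t t'; first exact: h.
  by rewrite enormC distrC; exact: h.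
move: tab t'ab => /andP[at_ tb] /andP[at' t'b].
rewrite enormC distrC (le_trans (chord_le_arclen at_ tt t'b))//.
by rewrite (arclenD _ at_ tt)// addrAC subrr add0r ler_norm.
Qed.

End rectifiable.
End ArcLength.

(** * Distance to the boundary and the density *)

Section BoundaryDistance.
Context {R : realType} {n : nat}.
Variable D : set 'rV[R]_n.
Hypotheses (n0 : (0 < n)%N) (D0 : D !=set0) (oD : open D) (bD : bounded_set D).
Implicit Types z w xi : 'rV[R]_n.

(** A segment that starts in [D] and avoids the boundary stays in [D]: its trace
    in [D] is both open and closed in the segment. *)
Lemma segment_sub z w : D z ->
  (forall t, 0 <= t <= 1 -> ~ boundary D (z + t *: (w - z))) -> D w.
Proof.
move=> Dz nb; pose f t := z + t *: (w - z).
have cf : continuous f.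
  move=> t; apply: cvgD; first exact: cvg_cst.
  by apply: cvgZr_tmp; exact: cvg_id.
have cA : connected (f @` `[0%R, 1%R]).
  apply: connected_continuous_connected; first exact: segment_connected.
  exact: continuous_subspaceT.
have eB : f @` `[0%R, 1%R] `&` D = f @` `[0%R, 1%R] `&` closure D.
  apply/seteqP; split => x [Ax Dx]; split => //; first exact: subset_closure.
  case: Ax Dx => t /=; rewrite in_itv/= => t01 <- cl.
  apply: contrapT => nD; apply: (nb t t01); split => //.
  by move=> Dox; apply: nD; exact: interior_subset Dox.
have h : f @` `[0%R, 1%R] `&` D = f @` `[0%R, 1%R].
  apply: cA; [|by exists D|by exists (closure D) => //; exact: closed_closure].
  exists z; split => //; exists 0; last by rewrite /f scale0r addr0.
  by rewrite /= in_itv/= lexx ler01.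
have : (f @` `[0%R, 1%R]) w.
  by exists 1; rewrite /f ?scale1r ?subrKC//= in_itv/= lexx ler01.
by rewrite -h => -[].
Qed.

Lemma bounded_norm : exists2 M, 0 < M & forall z, D z -> `|z| <= M.
Proof.
have [M [Mreal h]] := bD; exists (Num.max 1 (M + 1)); first by rewrite lt_max ltr01.
by move=> z Dz; apply: h => //; rewrite lt_max ltrDl ltr01 orbT.
Qed.

Lemma boundary_neq0 : boundary D !=set0.
Proof.
apply: contrapT => nb; have [M M0 hM] := bounded_norm; have [z Dz] := D0.
have : D (const_mx (M + 1)).
  apply: (segment_sub Dz) => t _ bt; apply: nb; eexists; exact: bt.
move=> /hM; apply/negP; rewrite -ltNge; apply: (@lt_le_trans _ _ (M + 1)).
  by rewrite ltrDl.
rewrite /Num.Def.normr/= mx_normrE.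
apply: le_trans (le_bigmax _ _ (ord0, Ordinal n0)) => /=.
by rewrite mxE ler_norm.
Qed.

Lemma boundary_notin xi : boundary D xi -> ~ D xi.
Proof. by move=> [_]; rewrite (interior_id _).1. Qed.

Lemma bdist_le z xi : boundary D xi -> boundary_dist D z <= enorm (z - xi).
Proof.
move=> bxi; apply: ge_inf; last by exists xi.
by exists 0 => _ [x _ <-]; exact: enorm_ge0.
Qed.

Lemma bdist_ge z r : (forall xi, boundary D xi -> r <= enorm (z - xi)) ->
  r <= boundary_dist D z.
Proof.
move=> h; apply: lb_le_inf; last by move=> _ [xi bxi <-]; exact: h.
by have [xi bxi] := boundary_neq0; exists (enorm (z - xi)); exists xi.
Qed.

Lemma bdist_lipschitz z w :
  `|boundary_dist D z - boundary_dist D w| <= enorm (z - w).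
Proof.
suff h x y : boundary_dist D x - boundary_dist D y <= enorm (x - y).
  by rewrite ler_norml h andbT lerNl opprB (le_trans (h _ _))// enormC.
rewrite lerBlDr -lerBlDl; apply: bdist_ge => xi bxi; rewrite lerBlDl.
by rewrite (le_trans (bdist_le x bxi))// ler_enormB.
Qed.

Lemma bdist_gt0 z : D z -> 0 < boundary_dist D z.
Proof.
move=> Dz; have /nbhs_ballP[r/= r0 hr] : nbhs z D by exact: open_nbhs_nbhs.
apply: (lt_le_trans r0); apply: bdist_ge => xi bxi.
rewrite leNgt; apply/negP => h; apply: (boundary_notin bxi); apply: hr.
by rewrite -ball_normE /ball_/= (le_lt_trans (norm_le_enorm _)).
Qed.

(** The Euclidean ball of radius [boundary_dist D z] around [z] lies in [D]. *)
Lemma bdist_ball z w : D z -> enorm (w - z) < boundary_dist D z -> D w.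
Proof.
move=> Dz h; apply: (segment_sub Dz) => t /andP[t0 t1] bt.
have := bdist_le z bt; rewrite opprD addNKr enormN enormZ ger0_norm//.
by apply/negP; rewrite -ltNge (le_lt_trans _ h)// ler_piMl// enorm_ge0.
Qed.

Lemma closure_bdist_gt0 z : closure D z -> 0 < boundary_dist D z -> D z.
Proof.
move=> cz dz; apply: contrapT => nD.
have bz : boundary D z by split => // Doz; apply: nD; exact: interior_subset Doz.
by have := bdist_le z bz; rewrite subrr enorm0 leNgt dz.
Qed.

Lemma diameter_ge z w : D z -> D w -> enorm (z - w) <= diameter D.
Proof.
move=> Dz Dw; have [M M0 hM] := bounded_norm.
apply: ub_le_sup; last by exists (z, w).
exists (n%:R * (M + M)) => _ [[x y] [/= /hM xM /hM yM] <-].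
rewrite (le_trans (enorm_le_norm _))// ler_wpM2l//.
by rewrite (le_trans (ler_normB _ _))// lerD.
Qed.

Lemma bdist_diameter z : D z -> boundary_dist D z *+ 2 <= diameter D.
Proof.
move=> Dz; set r := boundary_dist D z.
have r0 : 0 < r by exact: bdist_gt0.
pose v : 'rV[R]_n := delta_mx ord0 (Ordinal n0).
have v1 : enorm v = 1.
  rewrite /enorm (bigD1 (Ordinal n0))//= big1 => [|i iP].
    by rewrite mxE !eqxx expr1n addr0 sqrtr1.
  by rewrite mxE (negbTE iP) andbF expr0n.
apply/ler_addgt0Pr => e e0.
(* The points [z + t v] and [z - t v] lie in [D] and are [2 t] apart. *)
pose t := Num.max 0 (r - e / 2).
have t0 : 0 <= t by rewrite le_max lexx.
have tr : t < r by rewrite gt_max r0/=; lra.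
have te : r - e / 2 <= t by rewrite le_max lexx orbT.
have : enorm ((z + t *: v) - (z - t *: v)) <= diameter D.
  by apply: diameter_ge; apply: (bdist_ball Dz);
    rewrite addrAC subrr add0r ?enormN enormZ v1 ger0_norm// mulr1.
rewrite opprB addrC subrKA -scalerDl enormZ v1 mulr1 ger0_norm ?addr_ge0//.
rewrite mulr2n; lra.
Qed.

Section Density.
Local Notation delta := (boundary_dist D).

Lemma m_densityE z : D z ->
  m_density D z = (delta z)^-1 + (diameter D - delta z)^-1.
Proof.
move=> Dz; have r0 := bdist_gt0 Dz; have rd := bdist_diameter Dz.
rewrite /m_density; field; apply/andP; split; last by rewrite gt_eqF.
by rewrite gt_eqF//; move: rd; rewrite mulr2n; lra.
Qed.

Lemma bdist_inv_le_m z : D z -> (delta z)^-1 <= m_density D z.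
Proof.
move=> Dz; have r0 := bdist_gt0 Dz; have rd := bdist_diameter Dz.
rewrite m_densityE// lerDl invr_ge0; move: rd; rewrite mulr2n; lra.
Qed.

Lemma m_density_gt0 z : D z -> 0 < m_density D z.
Proof.
by move=> Dz; rewrite (lt_le_trans _ (bdist_inv_le_m Dz))// invr_gt0 bdist_gt0.
Qed.

Lemma m_density_lipschitz c z w : 0 < c -> D z -> D w ->
  c <= delta z -> c <= delta w ->
  `|m_density D z - m_density D w| <= 2 / c ^+ 2 * enorm (z - w).
Proof.
move=> c0 Dz Dw cz cw.
have inv_lip x y : c <= x -> c <= y -> `|x^-1 - y^-1| <= `|x - y| / c ^+ 2.
  move=> cx cy; have x0 := lt_le_trans c0 cx; have y0 := lt_le_trans c0 cy.
  have -> : x^-1 - y^-1 = (y - x) / (x * y).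
    by field; rewrite !gt_eqF.
  have xy0 : 0 < (x * y)^-1 by rewrite invr_gt0 mulr_gt0.
  rewrite normrM distrC ler_wpM2l// gtr0_norm//.
  by rewrite lef_pV2 ?posrE ?mulr_gt0// ?exprn_gt0// expr2; apply: ler_pM => //; exact: ltW.
have zd := bdist_diameter Dz; have wd := bdist_diameter Dw.
rewrite mulr2n in zd; rewrite mulr2n in wd.
rewrite !m_densityE// opprD addrACA (le_trans (ler_normD _ _))//.
have h := bdist_lipschitz z w.
have h1 := inv_lip _ _ cz cw.
have h2 : `|(diameter D - delta z)^-1 - (diameter D - delta w)^-1|
    <= `|delta z - delta w| / c ^+ 2.
  have -> : `|delta z - delta w| =
      `|(diameter D - delta z) - (diameter D - delta w)|.
    by rewrite distrC; congr (`| _ |); ring.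
  by apply: inv_lip; lra.
rewrite (le_trans (lerD h1 h2))//; set N := `| _ | in h *.
rewrite (_ : _ + _ = 2 / c ^+ 2 * N); last by ring.
by apply: ler_wpM2l => //; rewrite divr_ge0// sqr_ge0.
Qed.

End Density.
End BoundaryDistance.

(** * Quadratic increments and integrals of Lipschitz functions *)

Section RealFunctions.
Context {R : realType}.
Implicit Types (F psi : R -> R) (s t l T C K : R).

(** A function whose increments are at most a fixed multiple of the squares of
    the increments of its argument does not increase from 0 to [T]: add the
    increments over [N] equal steps and let [N] grow. *)
Lemma quadratic_increments psi C T : 0 <= C -> 0 <= T ->
  (forall t t', 0 <= t -> t <= t' -> t' <= T ->
    psi t' - psi t <= C * (t' - t) ^+ 2) ->
  psi T <= psi 0.
Proof.
move=> C0 T0 h; apply/ler_addgt0Pr => e e0.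
have [N N0 NE] : exists2 N, 0 < N%:R :> R & C * T ^+ 2 <= N%:R * e.
  exists (Num.trunc (C * T ^+ 2 / e)).+1; first by rewrite ltr0n.
  by rewrite -ler_pdivrMr// ltW// truncnS_gt.
pose st k : R := k%:R * (T / N%:R).
have TN : 0 <= T / N%:R by rewrite divr_ge0// ltW.
have step k : (k <= N)%N -> psi (st k) - psi 0 <= k%:R * (C * (T / N%:R) ^+ 2).
  elim: k => [|k ih] kN; first by rewrite /st !mul0r subrr.
  have stS : st k.+1 = st k + T / N%:R by rewrite /st -natr1 mulrDl mul1r.
  have h1 : psi (st k.+1) - psi (st k) <= C * (T / N%:R) ^+ 2.
    rewrite (_ : T / N%:R = st k.+1 - st k); last by rewrite stS addrC addKr.
    apply: h; first by rewrite /st mulr_ge0.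
      by rewrite stS lerDl.
    by rewrite /st mulrCA ler_piMr// ler_pdivrMr// mul1r ler_nat.
  have := ih (ltnW kN).
  by rewrite -natr1 mulrDl mul1r; lra.
have := step N (leqnn N).
have -> : st N = T by rewrite /st mulrCA divff ?gt_eqF// mulr1.
have -> : N%:R * (C * (T / N%:R) ^+ 2) = C * T ^+ 2 / N%:R.
  have : N%:R != 0 :> R by rewrite gt_eqF.
  move: (N%:R : R) => v v0.
  by field.
have : C * T ^+ 2 / N%:R <= e by rewrite ler_pdivrMr// [leRHS]mulrC.
lra.
Qed.

(** [F] is [K]-Lipschitz on the closed interval from 0 to [l]. *)
Definition lipschitz_seg F K l :=
  forall s t, 0 <= s <= l -> 0 <= t <= l -> `|F s - F t| <= K * `|s - t|.

Lemma lipschitz_seg_ge0 F K l : 0 < l -> lipschitz_seg F K l -> 0 <= K.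
Proof.
move=> l0 /(_ l 0); rewrite !lexx (ltW l0) subr0 (gtr0_norm l0) => /(_ isT isT) h.
by have := le_trans (normr_ge0 _) h; rewrite pmulr_lge0.
Qed.

Local Notation mu := (@lebesgue_measure R).

Lemma lipschitz_seg_continuous F K l : lipschitz_seg F K l ->
  {within `[0, l], continuous F}.
Proof.
move=> FK; apply/subspace_continuousP => x /=; rewrite in_itv/= => x0l.
apply/cvgrPdist_lt => e e0; rewrite near_withinE.
have K1 : 0 < `|K| + 1 by rewrite ltr_wpDl.
near=> y; rewrite /= in_itv/= => y0l.
have h : `|x - y| < e / (`|K| + 1).
  near: y; apply/nbhs_ballP; exists (e / (`|K| + 1)); last by move=> z.
  by rewrite /= divr_gt0.
rewrite ltr_pdivlMr// in h.
rewrite (le_lt_trans (FK x y x0l y0l))// (le_lt_trans _ h)// mulrC ler_wpM2l//.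
by rewrite (le_trans (ler_norm _))// lerDl.
Unshelve. all: by end_near. Qed.

Lemma lipschitz_seg_integrable F K l : lipschitz_seg F K l ->
  mu.-integrable `[0, l] (EFin \o F).
Proof.
move=> FK; apply: continuous_compact_integrable; first exact: segment_compact.
exact: lipschitz_seg_continuous FK.
Qed.

(** First order expansion of an indefinite integral, with the error term needed
    in [quadratic_increments]. *)
Lemma Rintegral_increment F K l s s' : lipschitz_seg F K l ->
  0 <= s -> s <= s' -> s' <= l ->
  `|\int[mu]_(x in `[0, s']) F x - \int[mu]_(x in `[0, s]) F x
    - F s * (s' - s)| <= K * (s' - s) ^+ 2.
Proof.
move=> FK s0 ss' s'l.
have [->|nss'] := eqVneq s s'.
  by rewrite !subrr mulr0 subr0 expr0n mulr0 normr0.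
have ltss' : s < s' by rewrite lt_neqAle nss'.
have K0 : 0 <= K.
  by apply: lipschitz_seg_ge0 FK; rewrite (lt_le_trans _ s'l)// (le_lt_trans s0).
have sub1 : `[0, s'] `<=` `[0, l] by apply: subset_itvl; rewrite bnd_simp.
have sub2 : `]s, s'] `<=` `[0, l].
  by apply: subset_itv; rewrite bnd_simp.
have i0 := lipschitz_seg_integrable FK.
have i1 : mu.-integrable `[0, s'] (EFin \o F) by apply: integrableS i0.
have i2 : mu.-integrable `]s, s'] (EFin \o F) by apply: integrableS i0.
rewrite (Rintegral_itvB i1) ?bnd_simp//.
have ic c : mu.-integrable `]s, s'] (EFin \o cst c).
  apply: (@integrableS _ _ _ mu `[0, l]) => //.
  apply: (@lipschitz_seg_integrable _ 0) => x y _ _.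
  by rewrite subrr normr0 mul0r.
have int_cst c : \int[mu]_(x in `]s, s']) (cst c) x = c * (s' - s).
  by rewrite Rintegral_cst//= lebesgue_measure_itv/= lte_fin ltss' EFinN -EFinB.
have FKx x : `]s, s']%classic x -> `|F x - F s| <= K * (s' - s).
  rewrite /= in_itv/= => /andP[sx xs'].
  rewrite (le_trans (FK x s _ _))//.
  - by rewrite (le_trans xs')// andbT ltW// (le_lt_trans s0).
  - by rewrite s0 (le_trans ss').
  by rewrite ler_wpM2l// gtr0_norm ?subr_gt0// lerD2r.
have e1 : (F s - K * (s' - s)) * (s' - s) <= \int[mu]_(x in `]s, s']) F x.
  rewrite -int_cst; apply: le_Rintegral => // x /FKx.
  by rewrite ler_norml /cst; lra.
have e2 : \int[mu]_(x in `]s, s']) F x <= (F s + K * (s' - s)) * (s' - s).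
  rewrite -int_cst; apply: le_Rintegral => // x /FKx.
  by rewrite ler_norml /cst; lra.
move: e1 e2; move: (Rintegral _ _ _) => I e1 e2.
by clear -e1 e2; rewrite ler_norml; lra.
Qed.

End RealFunctions.

(** * Lipschitz paths and weighted length *)

Section LipschitzPaths.
Context {R : realType} {n : nat}.
Implicit Types (h g : R -> 'rV[R]_n).

Lemma near_enorm (z : 'rV[R]_n) (e : R) : 0 < e ->
  \forall w \near z, enorm (w - z) < e.
Proof.
move=> e0; apply/nbhs_ballP; exists (e / n.+1%:R); first by rewrite /= divr_gt0.
move=> w; rewrite -ball_normE /ball_/= => zw.
rewrite enormC (le_lt_trans (enorm_le_norm _))//.
rewrite (@le_lt_trans _ _ (n.+1%:R * `|z - w|))//.
  by rewrite ler_wpM2r// ler_nat.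
by rewrite mulrC -ltr_pdivlMr.
Qed.

Lemma near_norm_lt (t d : R) : 0 < d -> \forall u \near t, `|u - t| < d.
Proof.
move=> d0; apply/nbhs_ballP; exists d => //= u.
by rewrite /ball/= distrC.
Qed.

Lemma within_continuous_enorm a b g : {within `[a, b], continuous g} ->
  forall t, a <= t <= b -> forall e, 0 < e ->
  exists2 d, 0 < d & forall u, a <= u <= b -> `|u - t| < d ->
    enorm (g u - g t) < e.
Proof.
move=> /subspace_continuousP cg t tab e e0.
have /cg : `[a, b]%classic t by rewrite /= in_itv.
move=> /(_ _ (near_enorm (g t) e0)).
rewrite /= /fmap /= => /nbhs_ballP[d /= d0 hd].
exists d => // u uab ut; apply: hd; last by rewrite /= in_itv.
by rewrite /ball/= distrC.
Qed.

(** [h] is [K]-Lipschitz on [[0, T]] for the Euclidean norm. *)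
Definition lipschitz_path h (K T : R) :=
  forall s t, 0 <= s <= T -> 0 <= t <= T -> enorm (h s - h t) <= K * `|s - t|.

Lemma lipschitz_path_continuous h K T : lipschitz_path h K T ->
  {within `[0, T], continuous h}.
Proof.
move=> hK; apply/subspace_continuousP => t /=; rewrite in_itv/= => t0T.
apply/cvgrPdist_lt => e e0; rewrite near_withinE.
have K1 : 0 < `|K| + 1 by rewrite ltr_wpDl.
have e1 : 0 < e / (`|K| + 1) by rewrite divr_gt0.
near=> u; rewrite /= in_itv/= => u0T.
have h0 : `|u - t| < e / (`|K| + 1) by near: u; exact: near_norm_lt.
rewrite ltr_pdivlMr// in h0.
rewrite (le_lt_trans (norm_le_enorm _))//.
rewrite (le_lt_trans (hK t u t0T u0T))// (le_lt_trans _ h0)// mulrC distrC.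
by rewrite ler_wpM2l// (le_trans (ler_norm _))// lerDl.
Unshelve. all: by end_near. Qed.

Lemma lipschitz_path_length_le h K T s t : lipschitz_path h K T ->
  0 <= s -> s <= t -> t <= T -> (path_length s t h <= (K * (t - s))%:E)%E.
Proof.
move=> hK + _ tT; move=> s0; apply: path_length_le => p.
elim: p s s0 => [|x p ih] s s0 st.
  by rewrite (itv_partition_nil st) subrr mulr0.
have xt := itv_partition_cons st.
have xlet := itv_partition_le xt.
have sx : s < x by case: st => /= /andP[].
rewrite /= (_ : K * (t - s) = K * (x - s) + K * (t - x)); last by ring.
apply: lerD; last by apply: ih => //; rewrite (le_trans s0)// ltW.
rewrite -(gtr0_norm (x := x - s)) ?subr_gt0//; apply: hK.
  by rewrite (le_trans s0 (ltW sx)) (le_trans xlet).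
by rewrite s0 (le_trans (ltW sx))// (le_trans xlet).
Qed.

End LipschitzPaths.

Section PathIntegral.
Context {R : realType} {n : nat}.
Variable D : set 'rV[R]_n.
Hypotheses (n0 : (0 < n)%N) (D0 : D !=set0) (oD : open D) (bD : bounded_set D).
Local Notation delta := (boundary_dist D).
Local Notation m := (m_density D).
Local Notation mu := (@lebesgue_measure R).

(** What the arguments below use of an arc length parametrization of total
    length [l]: a 1-Lipschitz path in [D] over [[0, l]]. The speed is not required
    to be equal to 1. *)
Definition unit_speed_path (x1 x2 : 'rV[R]_n) (l : R) (h : R -> 'rV[R]_n) :=
  [/\ 0 <= l, h 0 = x1, h l = x2, forall s, 0 <= s <= l -> D (h s) &
    lipschitz_path h 1 l].

Lemma arclength_param_unit_speed x1 x2 a b g : rectifiable_path D x1 x2 a b g ->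
  unit_speed_path x1 x2 (arclen g a b) (arclength_param a b g).
Proof.
move=> [[ab cg gD ga gb] fl].
have leab := ltW ab; have cg' := within_continuous_enorm cg.
split.
- exact: arclen_ge0.
- by rewrite -(arclenxx g a) arclength_paramE ?lexx.
- by rewrite arclength_paramE ?lexx ?leab.
- move=> s /(arclen_onto fl cg' leab)[t tab <-].
  by rewrite arclength_paramE//; apply: gD; rewrite in_itv.
- by move=> s t sl tl; rewrite mul1r arclength_param_lipschitz.
Qed.

Section unit_speed.
Variables (x1 x2 : 'rV[R]_n) (l : R) (h : R -> 'rV[R]_n).
Hypothesis uh : unit_speed_path x1 x2 l h.

Lemma m_unit_speed_lipschitz c : 0 < c ->
  (forall s, 0 <= s <= l -> c <= delta (h s)) ->
  lipschitz_seg (m \o h) (2 / c ^+ 2) l.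
Proof.
move=> c0 cd s t sl tl; have [_ _ _ hD hK] := uh.
apply: le_trans.
  by apply: (m_density_lipschitz n0 D0 oD bD c0);
    [exact: hD|exact: hD|exact: cd|exact: cd].
rewrite ler_wpM2l ?divr_ge0 ?sqr_ge0//.
by rewrite (le_trans (hK _ _ sl tl))// mul1r.
Qed.

Lemma bdist_unit_speed_lipschitz : lipschitz_seg (delta \o h) 1 l.
Proof.
move=> s t sl tl; have [_ _ _ _ hK] := uh.
exact: le_trans (bdist_lipschitz n0 D0 oD bD _ _) (hK _ _ sl tl).
Qed.

(** A single path stays away from the boundary, by compactness; unlike in
    [bdist_unit_speed_ge], the bound depends on the path. *)
Lemma unit_speed_bdist_min :
  exists2 c, 0 < c & forall s, 0 <= s <= l -> c <= delta (h s).
Proof.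
have [l0 _ _ hD _] := uh.
have [s sl hs] := EVT_min l0 (lipschitz_seg_continuous bdist_unit_speed_lipschitz).
exists (delta (h s)); last first.
  by move=> t tl; apply: hs; rewrite in_itv.
by apply: (bdist_gt0 n0) => //; apply: hD; rewrite in_itv in sl.
Qed.

(** Weighted length of the arc of [h] over [[0, s]]. *)
Definition m_length (s : R) : R := \int[mu]_(x in `[0, s]) (m \o h) x.

Lemma m_length0 : m_length 0 = 0.
Proof. by rewrite /m_length set_itv1 Rintegral_set1. Qed.

Lemma m_length_nondecr s t : 0 <= s -> s <= t -> t <= l ->
  m_length s <= m_length t.
Proof.
move=> s0 st tl; have [c c0 cd] := unit_speed_bdist_min.
have i0 := lipschitz_seg_integrable (m_unit_speed_lipschitz c0 cd).
have i1 : mu.-integrable `[0, t] (EFin \o (m \o h)).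
  by apply: integrableS i0 => //; apply: subset_itvl; rewrite bnd_simp.
rewrite -subr_ge0 /m_length (Rintegral_itvB i1) ?bnd_simp//.
apply: Rintegral_ge0 => x; rewrite /= in_itv/= => /andP[sx xt].
have [_ _ _ hD _] := uh; apply/ltW/m_density_gt0 => //; apply: hD.
by rewrite (le_trans xt)// andbT ltW// (le_lt_trans s0).
Qed.

Lemma m_length_ge0 s : 0 <= s -> s <= l -> 0 <= m_length s.
Proof. by move=> s0 sl; rewrite -m_length0 m_length_nondecr. Qed.

(** The distance to the boundary decays at most exponentially in the weighted
    length, since the density dominates [1 / delta]. *)
Lemma bdist_unit_speed_ge s : 0 <= s <= l ->
  delta x1 * expR (- m_length l) <= delta (h s).
Proof.
move=> /andP[s0 sl]; have [l0 h0 _ hD hK] := uh.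
have [c c0 cd] := unit_speed_bdist_min.
have FK := m_unit_speed_lipschitz c0 cd.
set K := 2 / c ^+ 2 in FK.
have K0 : 0 <= K by rewrite divr_ge0// sqr_ge0.
pose u t := delta (h t).
have u0 t : 0 <= t <= l -> 0 < u t by move=> /cd; exact: lt_le_trans.
(* With [d = t' - t], the increment of [- ln u] is at most [d / u t'] and that of
   [m_length] is at least [d / u t - K d^2]; as [u] is 1-Lipschitz and at least
   [c], the difference is at most [d^2 / c^2 + K d^2]. *)
have : - ln (u s) - m_length s <= - ln (u 0) - m_length 0.
  apply: (@quadratic_increments _ (fun t => - ln (u t) - m_length t)
    ((c ^+ 2)^-1 + K)) => //.
    by rewrite addr_ge0// invr_ge0 sqr_ge0.
  move=> t t' t0 tt' t's.
  have t'l := le_trans t's sl; have tl := le_trans tt' t'l.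
  have t'0 := le_trans t0 tt'.
  have ut : 0 < u t by apply: u0; rewrite t0.
  have ut' : 0 < u t' by apply: u0; rewrite t'0.
  have ct : c <= u t by apply: cd; rewrite t0.
  have ct' : c <= u t' by apply: cd; rewrite t'0.
  have := Rintegral_increment FK t0 tt' t'l.
  rewrite -/(m_length t) -/(m_length t'); move: (m_length t) (m_length t').
  move=> p p'; rewrite ler_norml => /andP[inc _].
  have mt : (u t)^-1 <= m (h t).
    by apply: bdist_inv_le_m => //; apply: hD; rewrite t0.
  have du : u t - u t' <= t' - t.
    have := @bdist_unit_speed_lipschitz t t'.
    rewrite t0 tl t'0 t'l mul1r => /(_ isT isT) /=.
    by rewrite ler_norml (ler0_norm (x := t - t')) ?subr_le0//; lra.
  have lnu : ln (u t) - ln (u t') <= (u t - u t') / u t'.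
    rewrite -ln_div ?posrE//.
    rewrite (_ : u t / u t' = 1 + (u t - u t') / u t'); last first.
      by field; rewrite gt_eqF.
    apply: le_ln1Dx; rewrite ltr_pdivlMr//; lra.
  move: inc lnu mt du ct ct' ut ut'; rewrite /=.
  move: (ln (u t)) (ln (u t')) (u t) (u t') (m (h t)).
  move=> la la' v v' f inc lnu mt du cv cv' v0 v'0.
  have d0 : 0 <= t' - t by rewrite subr_ge0.
  set d := t' - t in inc du d0 *.
  have e1 : (v - v') / v' <= d / v' by rewrite ler_pM2r ?invr_gt0.
  have e2 : d / v' - d / v <= d ^+ 2 / c ^+ 2.
    have -> : d / v' - d / v = d * (v - v') / (v * v').
      by field; rewrite !gt_eqF.
    have v2 : 0 < v * v' by rewrite mulr_gt0.
    rewrite (@le_trans _ _ (d ^+ 2 / (v * v')))//.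
      by rewrite ler_pM2r ?invr_gt0// expr2 ler_wpM2l.
    rewrite ler_wpM2l ?sqr_ge0// lef_pV2 ?posrE ?exprn_gt0// expr2.
    by apply: ler_pM => //; exact: ltW.
  have e3 : d / v <= f * d by rewrite [leRHS]mulrC ler_wpM2l.
  rewrite mulrDl [_^-1 * _]mulrC; lra.
rewrite m_length0 subr0 /u h0 => hln.
have x1D : D x1 by rewrite -h0; apply: hD; rewrite lexx.
have dx1 : 0 < delta x1 by exact: (bdist_gt0 n0).
have dhs : 0 < delta (h s) by apply: u0; rewrite s0.
rewrite -[leRHS](lnK dhs) -[delta x1](lnK dx1) -expRD ler_expR.
have := m_length_nondecr s0 sl (lexx l); lra.
Qed.

(** The density is at least [2 / diameter D], so the weighted length controls
    the length. *)
Lemma unit_speed_length_le : l * 2 <= m_length l * diameter D.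
Proof.
have [l0 h0 _ hD hK] := uh.
have [c c0 cd] := unit_speed_bdist_min.
have FK := m_unit_speed_lipschitz c0 cd.
set K := 2 / c ^+ 2 in FK.
have K0 : 0 <= K by rewrite divr_ge0// sqr_ge0.
have delta2 t : 0 <= t <= l -> delta (h t) *+ 2 <= diameter D.
  by move=> /hD; exact: bdist_diameter.
have diam0 : 0 < diameter D.
  have := delta2 0; rewrite lexx => /(_ l0); apply: lt_le_trans.
  by rewrite pmulrn_lgt0// (lt_le_trans c0)// cd// lexx.
have : 2 / diameter D * l - m_length l <= 2 / diameter D * 0 - m_length 0.
  apply: (@quadratic_increments _
    (fun t => 2 / diameter D * t - m_length t) K) => //.
  move=> t t' t0 tt' t'l; have tl : t <= l by exact: le_trans t'l.
  have := Rintegral_increment FK t0 tt' t'l.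
  rewrite -/(m_length t) -/(m_length t'); move: (m_length t) (m_length t').
  move=> p p'; rewrite ler_norml => /andP[inc _].
  have tl0 : 0 <= t <= l by rewrite t0.
  have mt : (delta (h t))^-1 <= m (h t).
    by apply: bdist_inv_le_m => //; exact: hD.
  have e : 2 / diameter D <= (m \o h) t.
    apply: le_trans mt; have dt := lt_le_trans c0 (cd t tl0).
    rewrite ler_pdivrMr// mulrC ler_pdivlMr//.
    by have := delta2 t tl0; rewrite mulr2n; lra.
  move: e inc; move: ((m \o h) t) (2 / diameter D) => f k e inc.
  have d0 : 0 <= t' - t by rewrite subr_ge0.
  have := ler_wpM2r d0 e; lra.
rewrite m_length0 mulr0 subr0 subr_le0 mulrAC ler_pdivrMr//; lra.
Qed.

End unit_speed.

Lemma path_integral_m x1 x2 a b g : rectifiable_path D x1 x2 a b g ->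
  path_integral a b g m =
  (m_length (arclength_param a b g) (arclen g a b))%:E.
Proof.
move=> /arclength_param_unit_speed ug; have [c c0 cd] := unit_speed_bdist_min ug.
have i0 := lipschitz_seg_integrable (m_unit_speed_lipschitz ug c0 cd).
by rewrite /path_integral /m_length /Rintegral fineK//; exact: integrable_fin_num.
Qed.

Lemma lipschitz_path_rectifiable x1 x2 T K h : 0 < T -> lipschitz_path h K T ->
  (forall t, 0 <= t <= T -> D (h t)) -> h 0 = x1 -> h T = x2 ->
  rectifiable_path D x1 x2 0 T h.
Proof.
move=> T0 hK hD h0 hT; split; first split => //.
  exact: lipschitz_path_continuous hK.
apply: le_lt_trans (ltry (K * (T - 0))).
exact: lipschitz_path_length_le hK (lexx 0) (ltW T0) (lexx T).
Qed.

Hypothesis cD : connected D.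

(** [y] is the end point of a Lipschitz path in [D] that starts from [x]. *)
Definition lipschitz_reachable (x y : 'rV[R]_n) := exists (h : R -> 'rV[R]_n) K T,
  [/\ 0 < T, lipschitz_path h K T, forall t, 0 <= t <= T -> D (h t), h 0 = x &
     h T = y].

(** Prolong the path by a segment, run through in unit time. *)
Lemma lipschitz_reachable_ball x y z : lipschitz_reachable x y ->
  enorm (z - y) < delta y -> lipschitz_reachable x z.
Proof.
move=> [h [K [T [T0 hK hD h0 hT]]]] zy.
have K0 : 0 <= K.
  have := hK T 0; rewrite !lexx (ltW T0) subr0 (gtr0_norm T0).
  move=> /(_ isT isT) hh; have := le_trans (enorm_ge0 _) hh.
  by rewrite pmulr_lge0.
have yD : D y by rewrite -hT; apply: hD; rewrite lexx ltW.
set E := enorm (z - y).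
have E0 : 0 <= E by exact: enorm_ge0.
pose f t := if t <= T then h t else y + (t - T) *: (z - y).
exists f, (K + E), (T + 1); split.
- by rewrite addr_gt0.
- move=> s t; wlog st : s t / s <= t.
    by move=> hh sT tT; have [st|/ltW st] := leP s t; [exact: hh|
      rewrite enormC distrC; exact: hh].
  move=> /andP[s0 sT] /andP[t0 tT].
  rewrite (ler0_norm (x := s - t)) ?subr_le0// opprB /f.
  have [tT'|Tt] := leP t T; have [sT'|Ts] := leP s T.
  + rewrite (le_trans (hK s t _ _)) ?s0 ?t0// ler0_norm ?subr_le0// opprB.
    by rewrite ler_wpM2r ?subr_ge0// lerDl.
  + lra.
  + rewrite (le_trans (ler_enormB y _ _))// -{1}hT opprD addNKr enormN enormZ -/E.
    have := hK s T; rewrite s0 sT' (ltW T0) lexx => /(_ isT isT).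
    rewrite (ler0_norm (x := s - T)) ?subr_le0// opprB gtr0_norm ?subr_gt0//.
    have e1 : 0 <= K * (t - T) by rewrite mulr_ge0// subr_ge0 ltW.
    have e2 : 0 <= E * (T - s) by rewrite mulr_ge0// subr_ge0.
    lra.
  + rewrite opprD addrACA subrr add0r -scalerBl enormZ -/E.
    have -> : s - T - (t - T) = s - t by ring.
    rewrite ler0_norm ?subr_le0// opprB mulrC ler_wpM2r ?subr_ge0//.
    by rewrite lerDr.
- move=> t /andP[t0 tT]; rewrite /f; have [tT'|Tt] := leP t T.
    by apply: hD; rewrite t0.
  apply: (bdist_ball oD yD); rewrite addrC addKr enormZ (le_lt_trans _ zy)//.
  by rewrite ler_piMl// gtr0_norm ?subr_gt0//; lra.
- by rewrite /f ltW.
- by rewrite /f leNgt ltrDl ltr01/= addrAC subrr add0r scale1r subrKC.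
Qed.

(** The set of points reachable from [x] is open and closed in [D]. *)
Lemma lipschitz_connected x y : D x -> D y -> lipschitz_reachable x y.
Proof.
move=> Dx Dy; pose B := [set z | D z /\ lipschitz_reachable x z].
suff h : B = D by rewrite -h in Dy; exact: Dy.2.
apply: cD.
- exists x; split => //; exists (fun=> x), 0, 1; split => //.
  by move=> s t _ _; rewrite subrr enorm0 mul0r.
- exists B; last by apply/seteqP; split => z; [case=> *; split|case].
  rewrite openE => z [Dz rz]; rewrite /interior.
  have dz : 0 < delta z by exact: (bdist_gt0 n0).
  apply: filterS (near_enorm z dz) => w wz.
  by split; [exact: bdist_ball wz|exact: lipschitz_reachable_ball wz].
exists (closure B); first exact: closed_closure.
apply/seteqP; split => z.
  by move=> Bz; split; [case: Bz|exact: subset_closure].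
move=> [Dz cz]; split => //.
have dz : 0 < delta z / 2 by rewrite divr_gt0// (bdist_gt0 n0).
have [w [[Dw rw] /= wz]] := cz _ (near_enorm z dz).
apply: (lipschitz_reachable_ball rw).
have := bdist_lipschitz n0 D0 oD bD w z.
by rewrite [enorm (z - w)]enormC ler_norml; lra.
Qed.

Lemma rectifiable_connected x y : D x -> D y ->
  exists (a b : R) (g : R -> 'rV[R]_n), rectifiable_path D x y a b g.
Proof.
move=> Dx Dy; have [h [K [T [T0 hK hD h0 hT]]]] := lipschitz_connected Dx Dy.
by exists 0, T, h; exact: (lipschitz_path_rectifiable T0 hK hD h0 hT).
Qed.

End PathIntegral.

(** * Limits of minimizing paths and existence of geodesics *)

(** Every family in a compact set converges along every ultrafilter on its
    index set. *)
Lemma ultra_compact_cvg (I : Type) (T : topologicalType) (U : set_system I)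
    (A : set T) (f : I -> T) : UltraFilter U -> compact A ->
  (forall i, A (f i)) -> exists2 l, A l & f @ U --> l.
Proof.
move=> UU cA fA; have PU : ProperFilter U by exact: ultra_proper.
have [l [Al cl]] : A `&` cluster (f @ U) !=set0.
  by apply: cA; apply: (@filterE _ U) => i; exact: fA.
exists l => // B lB.
have [//|nB] := in_ultra_setVsetC (f @^-1` B) UU.
by have [x []] := cl (~` B) B nB lB.
Qed.

Lemma cvg_cst_eq (K : numFieldType) (V : normedModType K) (I : Type)
    (F : set_system I) {FF : ProperFilter F} (f : I -> V) (a l : V) :
  (forall i, f i = a) -> f @ F --> l -> l = a.
Proof.
move=> fa; rewrite (_ : f = cst a); last exact/funext.
by move=> fl; apply: (cvg_unique (@norm_hausdorff _ V) fl); exact: cvg_cst.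
Qed.

Section Limits.
Context {R : realType} {n : nat} {I : Type} {F : set_system I}.
Context {FF : ProperFilter F}.
Implicit Types (f g : I -> 'rV[R]_n) (x y : 'rV[R]_n).

Lemma cvg_enorm_lipschitz (phi : 'rV[R]_n -> R) K f x : f @ F --> x ->
  (forall i, `|phi x - phi (f i)| <= K * enorm (f i - x)) ->
  phi (f i) @[i --> F] --> phi x.
Proof.
move=> fx h; apply/cvgrPdist_lt => e e0.
have K1 : 0 < `|K| + 1 by rewrite ltr_wpDl.
have e1 : 0 < e / (`|K| + 1) by rewrite divr_gt0.
have h1 : \forall i \near F, enorm (f i - x) < e / (`|K| + 1).
  exact: fx _ (near_enorm x e1).
apply: filterS h1 => i.
rewrite ltr_pdivlMr// => fi; rewrite (le_lt_trans (h i))// (le_lt_trans _ fi)//.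
rewrite mulrC ler_wpM2l ?enorm_ge0//.
by rewrite (le_trans (ler_norm _))// lerDl.
Qed.

Lemma cvg_enormB f g x y : f @ F --> x -> g @ F --> y ->
  enorm (f i - g i) @[i --> F] --> enorm (x - y).
Proof.
move=> fx gy.
apply: (@cvg_enorm_lipschitz (fun z => enorm z) 1 (fun i => f i - g i)).
  exact: cvgB.
move=> i; rewrite mul1r.
set z := f i - g i; set w := x - y.
have h1 := ler_enormD (z - w) w; have h2 := ler_enormD (w - z) z.
rewrite subrK in h1; rewrite subrK enormC in h2.
by rewrite ler_norml; lra.
Qed.

End Limits.

Section Geodesics.
Context {R : realType} {n : nat}.
Variable D : set 'rV[R]_n.
Hypotheses (n0 : (0 < n)%N) (D0 : D !=set0) (oD : open D) (bD : bounded_set D).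
Hypothesis cD : connected D.
Local Notation delta := (boundary_dist D).
Local Notation m := (m_density D).

(** Compactness of a minimizing sequence: the paths [t |-> h k (l k * t)] over
    [[0, 1]] converge along an ultrafilter to [H], the lengths [l k] to [L], and
    the weighted lengths of the arcs over [[0, l k * t]] to [J t]. *)
Lemma unit_speed_limit x1 x2 (M : R) (l : nat -> R)
    (h : nat -> R -> 'rV[R]_n) : 0 <= M ->
  (forall k, unit_speed_path D x1 x2 (l k) (h k)) ->
  (forall k, m_length D (h k) (l k) <= M + k.+1%:R^-1) ->
  exists c L H J, [/\ 0 < c, 0 <= L, lipschitz_path H L 1,
      H 0 = x1 /\ H 1 = x2 &
    [/\ J 0 = 0, J 1 <= M,
      forall t, 0 <= t <= 1 -> D (H t),
      forall t, 0 <= t <= 1 -> c <= delta (H t) &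
      forall t t', 0 <= t -> t <= t' -> t' <= 1 ->
        m (H t) * (L * (t' - t)) - 2 / c ^+ 2 * (L * (t' - t)) ^+ 2
          <= J t' - J t]].
Proof.
move=> M0 uh hM.
have l0 k : 0 <= l k by case: (uh k).
have hM1 k : m_length D (h k) (l k) <= M + 1.
  by rewrite (le_trans (hM k))// lerD2l invf_le1 ?ltr0n// ler1n.
have x1D : D x1 by have [? <- _ + _] := uh 0%N; apply; rewrite lexx.
have dx1 : 0 < delta x1 by exact: (bdist_gt0 n0).
(* All weighted lengths are at most [M + 1], so this bound is uniform in [k]. *)
pose c := delta x1 * expR (- (M + 1)).
have c0 : 0 < c by rewrite mulr_gt0 ?expR_gt0.
have cd k s : 0 <= s <= l k -> c <= delta (h k s).
  move=> sl; apply: le_trans (bdist_unit_speed_ge n0 D0 oD bD (uh k) sl).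
  by rewrite ler_pM2l// ler_expR lerN2.
have diam0 : 0 <= diameter D.
  by rewrite (le_trans _ (bdist_diameter n0 D0 oD bD x1D))// mulrn_wge0// ltW.
pose Lam := (M + 1) * diameter D / 2.
have lLam k : l k <= Lam.
  rewrite ler_pdivlMr// (le_trans (unit_speed_length_le n0 D0 oD bD (uh k)))//.
  by rewrite ler_wpM2r.
have lt_itv k (t : R) : 0 <= t <= 1 -> 0 <= l k * t <= l k.
  by move=> /andP[t0 t1]; rewrite mulr_ge0//= ler_piMr.
(* An ultrafilter that contains the neighbourhoods of infinity replaces the
   extraction of subsequences. *)
have [U [UU sU]] := ultraFilterLemma (@eventually_filter).
have PU : ProperFilter U by exact: ultra_proper.
have [L] : exists2 L, `[0, Lam]%classic L & l @ U --> L.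
  apply: ultra_compact_cvg UU (@segment_compact _ _ _) _ => k.
  by rewrite /= in_itv/= l0 lLam.
rewrite /= in_itv/= => /andP[L0 _] lL.
have [B B0 hB] := bounded_norm bD.
have exH (t : R) : exists y : 'rV[R]_n,
    0 <= t <= 1 -> h k (l k * t) @[k --> U] --> y.
  have [t01|nt] := boolP (0 <= t <= 1); last by exists 0.
  have cB : compact [set x : 'rV[R]_n | `|x| <= B].
    apply: bounded_closed_compact.
      exists B; split; first exact: num_real.
      by move=> x Bx y /le_trans; apply; exact: ltW.
    by apply: preimage_closed (@closed_le _ B) => x _; exact: norm_continuous.
  have [y _ hy] := ultra_compact_cvg (f := fun k => h k (l k * t)) UU cB (fun k =>
    let: And5 _ _ _ hD _ := uh k in hB _ (hD _ (lt_itv k t t01))).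
  by exists y.
have [H Hlim] := choice exH.
have exJ (t : R) : exists y : R,
    0 <= t <= 1 -> m_length D (h k) (l k * t) @[k --> U] --> y.
  have [t01|nt] := boolP (0 <= t <= 1); last by exists 0.
  have [|y _ hy] := ultra_compact_cvg (f := fun k => m_length D (h k) (l k * t))
      UU (@segment_compact _ 0 (M + 1)).
    move=> k; rewrite /= in_itv/=; have /andP[lt0 ltl] := lt_itv k t t01.
    rewrite (m_length_ge0 n0 D0 oD bD (uh k))//=.
    by rewrite (le_trans _ (hM1 k))// (m_length_nondecr n0 D0 oD bD (uh k)).
  by exists y.
have [J Jlim] := choice exJ.
have i0 : is_true ((0 <= 0 :> R) && (0 <= 1 :> R)) by rewrite lexx ler01.
have i1 : is_true ((0 <= 1 :> R) && (1 <= 1 :> R)) by rewrite lexx ler01.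
have dH (t : R) : 0 <= t <= 1 -> delta (h k (l k * t)) @[k --> U] --> delta (H t).
  move=> t01; apply: (cvg_enorm_lipschitz (K := 1) (Hlim t t01)) => k.
  by rewrite mul1r distrC bdist_lipschitz.
have cH (t : R) : 0 <= t <= 1 -> c <= delta (H t).
  move=> t01; apply: cvgr_to_ge (dH t t01) _.
  by apply: filterE => k; exact/cd/lt_itv.
have DH (t : R) : 0 <= t <= 1 -> D (H t).
  move=> t01; apply: closure_bdist_gt0; last exact: lt_le_trans (cH t t01).
  apply: (closed_cvg (@closure _ D)) (Hlim t t01); first exact: closed_closure.
  apply: filterE => k; apply: subset_closure.
  by have [_ _ _ hD _] := uh k; exact/hD/lt_itv.
have mH (t : R) : 0 <= t <= 1 -> m (h k (l k * t)) @[k --> U] --> m (H t).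
  move=> t01; apply: (cvg_enorm_lipschitz (K := 2 / c ^+ 2) (Hlim t t01)) => k.
  rewrite enormC; have [_ _ _ hD _] := uh k.
  apply: (m_density_lipschitz n0 D0 oD bD c0); [exact: DH| |exact: cH|].
    exact/hD/lt_itv.
  exact/cd/lt_itv.
exists c, L, H, J; split => //.
- move=> s t s01 t01.
  apply: ler_cvg_to (cvg_enormB (Hlim s s01) (Hlim t t01))
    (cvgMr_tmp (b := `|s - t|) lL) _.
  apply: filterE => k /=; have [_ _ _ _ hK] := uh k.
  rewrite (le_trans (hK _ _ (lt_itv k s s01) (lt_itv k t t01)))// mul1r.
  by rewrite -mulrBr normrM ger0_norm.
- split.
    apply: cvg_cst_eq (Hlim 0 i0) => k.
    by rewrite mulr0; have [_ -> _ _ _] := uh k.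
  apply: cvg_cst_eq (Hlim 1 i1) => k.
  by rewrite mulr1; have [_ _ -> _ _] := uh k.
split => //.
- apply: cvg_cst_eq (Jlim 0 i0) => k.
  by rewrite mulr0 m_length0.
- have MU : M + k.+1%:R^-1 @[k --> U] --> M + 0.
    apply: cvgD; first exact: cvg_cst.
    by apply: cvg_trans (@cvg_harmonic R) => A; exact: sU.
  rewrite -[leRHS]addr0; apply: ler_cvg_to (Jlim 1 i1) MU _.
  by apply: filterE => k /=; rewrite mulr1.
move=> t t' t0 tt' t'1.
have t01 : 0 <= t <= 1 by rewrite t0 (le_trans tt').
have t'01 : 0 <= t' <= 1 by rewrite t'1 (le_trans t0).
have lLd : l k * (t' - t) @[k --> U] --> L * (t' - t) by exact: cvgMr_tmp.
have lhs : m (h k (l k * t)) * (l k * (t' - t)) -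
    2 / c ^+ 2 * (l k * (t' - t) * (l k * (t' - t))) @[k --> U] -->
    m (H t) * (L * (t' - t)) - 2 / c ^+ 2 * (L * (t' - t) * (L * (t' - t))).
  apply: cvgB; first by apply: cvgM lLd; exact: mH.
  by apply: cvgMl_tmp; exact: cvgM.
have rhs : m_length D (h k) (l k * t') - m_length D (h k) (l k * t) @[k --> U]
    --> J t' - J t.
  by apply: cvgB; exact: Jlim.
rewrite [(L * _) ^+ 2]expr2; apply: ler_cvg_to lhs rhs _.
apply: filterE => k /=.
have FK := m_unit_speed_lipschitz n0 D0 oD bD (uh k) c0 (cd k).
have /andP[a0 _] := lt_itv k t t01; have /andP[_ a1] := lt_itv k t' t'01.
have := Rintegral_increment FK a0 (ler_wpM2l (l0 k) tt') a1.
rewrite -/(m_length D (h k) (l k * t)) -/(m_length D (h k) (l k * t')).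
move: (m_length D (h k) (l k * t)) (m_length D (h k) (l k * t')) => p p'.
by rewrite ler_norml -mulrBr expr2 /=; lra.
Qed.

Lemma m_geodesic_exists x1 x2 : D x1 -> D x2 ->
  exists (a b : R) (g : R -> 'rV[R]_n), m_geodesic D x1 x2 a b g.
Proof.
move=> Dx1 Dx2.
set S : set (\bar R) := [set l | exists (a b : R) (g : R -> 'rV[R]_n),
    rectifiable_path D x1 x2 a b g /\ l = path_integral a b g m].
have S0 y : S y -> (0 <= y)%E.
  move=> [a [b [g [rg ->]]]]; rewrite (path_integral_m n0 D0 oD bD rg) lee_fin.
  have ug := arclength_param_unit_speed rg.
  by apply: (m_length_ge0 n0 D0 oD bD ug) => //; case: ug.
have [a0 [b0 [g0 rg0]]] := rectifiable_connected n0 D0 oD bD cD Dx1 Dx2.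
have m_fin : m_dist D x1 x2 \is a fin_num.
  rewrite ge0_fin_numE; last by apply: le_ereal_inf_tmp => y; exact: S0.
  apply: (@le_lt_trans _ _ (path_integral a0 b0 g0 m)).
    by apply: ereal_inf_lbound; exists a0, b0, g0.
  by rewrite (path_integral_m n0 D0 oD bD rg0) ltry.
set M := fine (m_dist D x1 x2).
have ME : m_dist D x1 x2 = M%:E by rewrite fineK.
have M0 : 0 <= M.
  by rewrite -lee_fin -ME; apply: le_ereal_inf_tmp => y; exact: S0.
have exk (k : nat) : exists p : R * (R -> 'rV[R]_n),
    unit_speed_path D x1 x2 p.1 p.2 /\ m_length D p.2 p.1 <= M + k.+1%:R^-1.
  have : (m_dist D x1 x2 < (M + k.+1%:R^-1)%:E)%E.
    by rewrite ME lte_fin ltrDl invr_gt0 ltr0n.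
  move=> /ereal_inf_lt[_ [a [b [g [rg ->]]]]].
  rewrite (path_integral_m n0 D0 oD bD rg) lte_fin => /ltW h.
  exists (arclen g a b, arclength_param a b g); split => //.
  exact: arclength_param_unit_speed rg.
(* [p] is a minimizing sequence of lengths and arc length parametrizations. *)
have [p hp] := choice exk.
have [c [L [H [J [c0 L0 HK [H0 H1] [J0 J1 DH cH incJ]]]]]] :=
  unit_speed_limit M0 (fun k => (hp k).1) (fun k => (hp k).2).
have rH := lipschitz_path_rectifiable ltr01 HK DH H0 H1.
exists 0, 1, H; split => //.
apply/eqP; rewrite eq_le; apply/andP; split; last first.
  by apply: ereal_inf_lbound; exists 0, 1, H.
rewrite (path_integral_m n0 D0 oD bD rH) ME lee_fin; apply: le_trans J1.
have uH := arclength_param_unit_speed rH.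
have [[_ contH _ _ _] finH] := rH.
have contH' := within_continuous_enorm contH.
set h := arclength_param 0 1 H in uH *; set sg := arclen H 0.
have cd s : 0 <= s <= sg 1 -> c <= delta (h s).
  move=> /(arclen_onto finH contH' ler01)[t t01 <-].
  by rewrite /h arclength_paramE//; exact: cH.
have FK := m_unit_speed_lipschitz n0 D0 oD bD uH c0 cd.
set K := 2 / c ^+ 2 in FK incJ.
have K0 : 0 <= K by rewrite divr_ge0// sqr_ge0.
(* [h] is the arc length parametrization of [H], so [h (sg t)] is [H t]. *)
have : m_length D h (sg 1) - J 1 <= m_length D h (sg 0) - J 0.
  apply: (@quadratic_increments _ (fun t => m_length D h (sg t) - J t)
    (2 * K * L ^+ 2)) => //; first by rewrite mulr_ge0 ?sqr_ge0// mulr_ge0.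
  move=> t t' t0 tt' t'1.
  have t1 := le_trans tt' t'1.
  have s0 : 0 <= sg t by exact: arclen_ge0.
  have sD : sg t' = sg t + arclen H t t' by exact: (arclenD finH).
  have st : sg t <= sg t' by rewrite sD lerDl arclen_ge0.
  have s1 : sg t' <= sg 1.
    by apply: (arclen_nondecr finH) => //; exact: le_trans tt'.
  have sl : sg t' - sg t <= L * (t' - t).
    rewrite sD addrAC subrr add0r -lee_fin -(path_length_fin finH)//.
    exact: lipschitz_path_length_le HK t0 tt' t'1.
  have := Rintegral_increment FK s0 st s1.
  rewrite -/(m_length D h (sg t)) -/(m_length D h (sg t')) /=.
  rewrite /h arclength_paramE ?t0// -/h.
  have := incJ t t' t0 tt' t'1.
  have : 0 < m (H t) by apply: m_density_gt0 => //; apply: DH; rewrite t0.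
  move: (m (H t)) => f f0.
  move: (m_length D h (sg t)) (m_length D h (sg t')) => q q'.
  have : 0 <= sg t' - sg t by rewrite subr_ge0.
  move: (sg t' - sg t) (J t') (J t) sl => d j' j sl d0 incj.
  rewrite ler_norml => /andP[_ inc].
  have e1 : f * d <= f * (L * (t' - t)) by rewrite ler_pM2l.
  have e2 : K * d ^+ 2 <= K * (L * (t' - t)) ^+ 2.
    by rewrite ler_wpM2l// ler_pXn2r// nnegrE (le_trans d0).
  rewrite (_ : 2 * K * L ^+ 2 * _ = K * (L * (t' - t)) ^+ 2 *+ 2); last by ring.
  rewrite mulr2n; lra.
have -> : sg 0 = 0 by exact: arclenxx.
by rewrite m_length0 J0 subr0 subr_le0.
Qed.

End Geodesics.

Theorem theorem4p4 (R : realType) (n : nat) (hn : (2 <= n)%N)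
  (D : set 'rV[R]_n) (hD : is_domain D) (hbD : bounded_set D)
  (x1 x2 : 'rV[R]_n) (hx1 : D x1) (hx2 : D x2) :
  exists (a b : R) (g : R -> 'rV[R]_n), m_geodesic D x1 x2 a b g.
Proof.
case: hD => D0 oD cD.
exact: (m_geodesic_exists (ltnW hn) D0 oD hbD cD hx1 hx2).
Qed.
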